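(* Let $\widetilde A\in\mathbb{R}^{m\times n}$, $\widetilde A\neq 0$, and $\widetilde b\in\mathbb{R}^m$ be fixed, let $x_0\in\mathbb{R}^n$ be arbitrary, and let $\{x_k\}$ be the iterates of the randomized Kaczmarz algorithm applied to $\widetilde A x\approx\widetilde b$ and started at $x_0$. Then for any $x_*\in\mathbb{R}^n$ and every $k\ge 0$, $$\mathbb{E}\,\| x_{k} -x_0^n- x_*^r\|^2 \le \left(1-\frac{1}{\widetilde R}\right)^{k}\| x_0^r-x_*^r \|^2+ \frac{\| \widetilde A x_* - \widetilde b \|^2}{\widetilde{\sigma}_{\min}^2},$$ where $\widetilde\sigma_{\min}$ is the smallest nonzero singular value of $\widetilde A$ and $\widetilde R=\|\widetilde A\|_F^2/\widetilde\sigma_{\min}^2$.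
   Context: Randomized Kaczmarz (RK) algorithm applied to $\widetilde A x\approx \widetilde b$ (a possibly inconsistent system): let $\widetilde a_i^\top$ denote the $i$-th row of $\widetilde A$. Starting from a deterministic $x_0\in\mathbb{R}^n$, for $k=0,1,2,\dots$, $$x_{k+1}=x_k-\frac{\widetilde a_{i(k)}^\top x_k-\widetilde b_{i(k)}}{\|\widetilde a_{i(k)}\|^2}\,\widetilde a_{i(k)},$$ where the indices $i(k)$ are drawn independently from $\{1,\dots,m\}$ with $\mathrm{Prob}(i(k)=i)=\|\widetilde a_i\|^2/\|\widetilde A\|_F^2$ (so zero rows are never selected). The expectation is over the random choice of indices. Here $\|\cdot\|$ is the Euclidean norm and $\|\cdot\|_F$ the Frobenius norm. For $v\in\mathbb{R}^n$, $v^r$ denotes the orthogonal projection of $v$ onto $\mathrm{range}(\widetilde A^\top)$ and $v^n$ the orthogonal projection of $v$ onto $\mathrm{null}(\widetilde A)$. *)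

(* Defs.v *)
From HB Require Import structures.
From mathcomp Require Import all_boot all_order all_algebra.
From mathcomp Require Import finmap.
From mathcomp Require Import all_classical all_reals all_analysis.

Set Implicit Arguments.
Unset Strict Implicit.
Unset Printing Implicit Defensive.

Import Order.TTheory GRing.Theory Num.Theory.

Local Open Scope classical_set_scope.
Local Open Scope ring_scope.

Section LinearAlgebra.
Context {R : realType}.

Definition dotv n (u v : 'cV[R]_n) : R := (u^T *m v) 0 0.

(* The norm `|v| that the library puts on matrices is the max norm, hence
   these separate Euclidean and Frobenius norms. *)
Definition norm2 n (v : 'cV[R]_n) : R := Num.sqrt (\sum_i v i 0 ^+ 2).

Definition frobenius m n (A : 'M[R]_(m, n)) : R :=
  Num.sqrt (\sum_i \sum_j A i j ^+ 2).

Definition rowv m n (A : 'M[R]_(m, n)) (i : 'I_m) : 'cV[R]_n := (row i A)^T.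

(* The singular values of A are the nonnegative square roots of the
   eigenvalues of A^T A. *)
Definition singular_value m n (A : 'M[R]_(m, n)) (s : R) : Prop :=
  0 <= s /\ eigenvalue (A^T *m A) (s ^+ 2).

(* For A != 0 this set is finite and nonempty, so the infimum is a minimum. *)
Definition sigma_min m n (A : 'M[R]_(m, n)) : R :=
  inf [set s | singular_value A s /\ s != 0].

Definition rtilde m n (A : 'M[R]_(m, n)) : R :=
  frobenius A ^+ 2 / sigma_min A ^+ 2.

(* Used only for linear subspaces S, where exactly one p qualifies; the
   default value 0 is then irrelevant. *)
Definition orth_proj n (S : set 'cV[R]_n) (v : 'cV[R]_n) : 'cV[R]_n :=
  xget 0 [set p | S p /\ forall w, S w -> dotv (v - p) w = 0].

Definition range_tr m n (A : 'M[R]_(m, n)) : set 'cV[R]_n :=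
  range (fun y : 'cV[R]_m => A^T *m y).

Definition null_space m n (A : 'M[R]_(m, n)) : set 'cV[R]_n :=
  [set z | A *m z = 0].

Definition rpart m n (A : 'M[R]_(m, n)) := orth_proj (range_tr A).

Definition npart m n (A : 'M[R]_(m, n)) := orth_proj (null_space A).

(* On a zero row this step is the identity, as 0 / 0 = 0; such rows have
   selection probability 0. *)
Definition kaczmarz_step m n (A : 'M[R]_(m, n)) (b : 'cV[R]_m) (i : 'I_m)
    (x : 'cV[R]_n) : 'cV[R]_n :=
  x - ((dotv (rowv A i) x - b i 0) / norm2 (rowv A i) ^+ 2) *: rowv A i.

Fixpoint kaczmarz m n (A : 'M[R]_(m, n)) (b : 'cV[R]_m) (x0 : 'cV[R]_n)
    (s : nat -> 'I_m) (k : nat) : 'cV[R]_n :=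
  if k is k'.+1 then kaczmarz_step A b (s k') (kaczmarz A b x0 s k') else x0.

End LinearAlgebra.

Section RandomIndices.
Context {R : realType} {d : measure_display} {T : measurableType d}.
Variable P : probability T R.

(* 'I_m carries its discrete sigma-algebra: every subset is measurable. *)
Definition index_measurable m (i : nat -> T -> 'I_m) : Prop :=
  forall (t : nat) (B : set 'I_m), measurable (i t @^-1` B).

Definition mutually_independent m (i : nat -> T -> 'I_m) : Prop :=
  forall (J : {fset nat}) (B : nat -> set 'I_m),
    P (\bigcap_(t in [set` J]) (i t @^-1` B t)) =
    (\prod_(t <- J) P (i t @^-1` B t))%E.

Definition kaczmarz_indices m n (A : 'M[R]_(m, n)) (i : nat -> T -> 'I_m) :
    Prop :=
  [/\ index_measurable i,
      mutually_independent i
    & forall t j, P (i t @^-1` [set j]) =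
        (norm2 (rowv A j) ^+ 2 / frobenius A ^+ 2)%:E].

End RandomIndices.

(* Main.v *)
Require Import Defs.
From HB Require Import structures.
From mathcomp Require Import all_boot all_order all_algebra.
From mathcomp Require Import finmap.
From mathcomp Require Import all_classical all_reals all_analysis.
From mathcomp Require Import measurable_realfun ring lra.

Set Implicit Arguments.
Unset Strict Implicit.
Unset Printing Implicit Defensive.

Import Order.TTheory GRing.Theory Num.Theory.
Import numFieldNormedType.Exports.

Local Open Scope classical_set_scope.
Local Open Scope ring_scope.

(** Put xh := npart A x0 + rpart A xs and e := x - xh. The starting error is
    rpart A x0 - rpart A xs, which lies in the row space range(A^T), and each step
    moves x along a row of A, so the error never leaves the row space.

    A step at row a_j projects orthogonally onto the hyperplane a_j . x = b_j,
    whose equation xh satisfies up to r_j := (A xh - b)_j, and expanding the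
    square gives
      |e'|^2 = |e|^2 + (r_j^2 - (a_j . e)^2) / |a_j|^2.
    Row j is drawn with probability |a_j|^2 / |A|_F^2, which cancels the
    denominator; the mean over j is
      |e|^2 - |A e|^2 / |A|_F^2 + |A xh - b|^2 / |A|_F^2,
    and |A e|^2 >= sigma_min^2 |e|^2 for e in the row space. With
    q := 1 - 1 / rtilde this reads
      E |e'|^2 <= q |e|^2 + (1 - q) c,  c := |A xh - b|^2 / sigma_min^2,
    so |e|^2 - c contracts by q in the mean, and q >= 0. Finally A xh = A xs.
    This is [kaczmarz_step_contraction] and [iter_step_mean_bound].

    The bound on |A e| is where sigma_min, an infimum over square roots of
    eigenvalues of A^T A, has to be compared with a quadratic form. The form
    |A u|^2 attains its minimum l on the compact unit sphere of the row space; a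
    minimiser is an eigenvector of A^T A for l, and conversely every eigenvector
    of A^T A with nonzero eigenvalue lies in the row space, so that
    sigma_min^2 = l ([sigma_min_range_bound]).

    On the probabilistic side, the iterate x_k takes finitely many values, and
    independence is only needed through cylinder events. Averaging over one step
    is an operator W on functions of the iterate ([step_mean]), and E f(x_k) is
    the k-fold iterate of W applied to f, at x0 ([expectation_iterate]). *)

(** * Euclidean inner product, row space and null space *)

Section LinearAlgebraFacts.
Context {R : realType}.
Implicit Types (m n : nat).

Lemma dotvE n (u v : 'cV[R]_n) : dotv u v = \sum_i u i 0 * v i 0.
Proof. by rewrite /dotv mxE; apply: eq_bigr => i _; rewrite mxE. Qed.

Lemma norm2_sqr n (v : 'cV[R]_n) : norm2 v ^+ 2 = dotv v v.
Proof.
rewrite sqr_sqrtr ?dotvE; last by apply: sumr_ge0 => i _; exact: sqr_ge0.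
by apply: eq_bigr => i _; rewrite expr2.
Qed.

Lemma dotvC n (u v : 'cV[R]_n) : dotv u v = dotv v u.
Proof. by rewrite !dotvE; apply: eq_bigr => i _; rewrite mulrC. Qed.

Lemma dotvDl n (u v w : 'cV[R]_n) : dotv (u + v) w = dotv u w + dotv v w.
Proof. by rewrite /dotv linearD mulmxDl mxE. Qed.

Lemma dotvZl n a (u w : 'cV[R]_n) : dotv (a *: u) w = a * dotv u w.
Proof. by rewrite /dotv linearZ -scalemxAl mxE. Qed.

Lemma dotvNl n (u w : 'cV[R]_n) : dotv (- u) w = - dotv u w.
Proof. by rewrite -scaleN1r dotvZl mulN1r. Qed.

Lemma dotvDr n (u v w : 'cV[R]_n) : dotv w (u + v) = dotv w u + dotv w v.
Proof. by rewrite dotvC dotvDl !(dotvC w). Qed.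

Lemma dotvZr n a (u w : 'cV[R]_n) : dotv w (a *: u) = a * dotv w u.
Proof. by rewrite dotvC dotvZl dotvC. Qed.

Lemma dotvNr n (u w : 'cV[R]_n) : dotv w (- u) = - dotv w u.
Proof. by rewrite dotvC dotvNl dotvC. Qed.

Definition dotv_lin := (dotvDl, dotvDr, dotvNl, dotvNr, dotvZl, dotvZr).

Lemma dotv0l n (w : 'cV[R]_n) : dotv 0 w = 0.
Proof. by rewrite -(scale0r 0) dotvZl mul0r. Qed.

Lemma dotv_ge0 n (v : 'cV[R]_n) : 0 <= dotv v v.
Proof. by rewrite -norm2_sqr sqr_ge0. Qed.

Lemma dotv_eq0 n (v : 'cV[R]_n) : (dotv v v == 0) = (v == 0).
Proof.
apply/idP/eqP => [|->]; last by rewrite dotv0l.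
rewrite dotvE psumr_eq0 => [/allP h|i _]; last by rewrite -expr2 sqr_ge0.
apply/colP => i; rewrite mxE; apply/eqP; rewrite -sqrf_eq0 expr2.
by apply: h; rewrite mem_index_enum.
Qed.

Lemma dotv_gt0 n (v : 'cV[R]_n) : (0 < dotv v v) = (v != 0).
Proof. by rewrite lt_neqAle dotv_ge0 andbT eq_sym dotv_eq0. Qed.

Lemma dotv_cauchy_schwarz n (u v : 'cV[R]_n) :
  dotv u v * dotv u v <= dotv u u * dotv v v.
Proof.
have [->|u0] := eqVneq u 0; first by rewrite !dotv0l !mul0r.
have uu : 0 < dotv u u by rewrite dotv_gt0.
have h := dotv_ge0 (dotv u u *: v - dotv u v *: u).
rewrite -subr_ge0 -(pmulr_rge0 _ uu); apply: (le_trans h).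
by rewrite !dotv_lin (dotvC v u) le_eqVlt; apply/orP; left; apply/eqP; ring.
Qed.

Lemma dotv_trmx m n (A : 'M[R]_(m, n)) (u : 'cV[R]_m) (v : 'cV[R]_n) :
  dotv (A^T *m u) v = dotv u (A *m v).
Proof. by rewrite /dotv trmx_mul trmxK mulmxA. Qed.

Lemma dotv_rowv m n (A : 'M[R]_(m, n)) i (v : 'cV[R]_n) :
  dotv (rowv A i) v = (A *m v) i 0.
Proof. by rewrite /dotv /rowv trmxK -row_mul mxE. Qed.

Lemma frobenius_sqr m n (A : 'M[R]_(m, n)) :
  frobenius A ^+ 2 = \sum_i dotv (rowv A i) (rowv A i).
Proof.
rewrite sqr_sqrtr; last by do 2 (apply: sumr_ge0 => ? _); exact: sqr_ge0.
apply: eq_bigr => i _; rewrite dotvE; apply: eq_bigr => j _.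
by rewrite !mxE expr2.
Qed.

Lemma exists_rowv_neq0 m n (A : 'M[R]_(m, n)) : A != 0 -> exists i, rowv A i != 0.
Proof.
move=> A0; apply/existsP; apply: contraNT A0; rewrite negb_exists => /forallP h.
apply/eqP/row_matrixP => i; rewrite row0; apply/trmx_inj; rewrite trmx0.
by have := h i; rewrite negbK => /eqP.
Qed.

Lemma frobenius_sqr_gt0 m n (A : 'M[R]_(m, n)) : A != 0 -> 0 < frobenius A ^+ 2.
Proof.
move=> /exists_rowv_neq0[i Ai0]; rewrite frobenius_sqr (bigD1 i)//=.
by rewrite ltr_pwDl ?dotv_gt0// sumr_ge0// => j _; exact: dotv_ge0.
Qed.

Lemma range_trD m n (A : 'M[R]_(m, n)) u v :
  range_tr A u -> range_tr A v -> range_tr A (u + v).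
Proof. by move=> [y _ <-] [z _ <-]; exists (y + z) => //; rewrite mulmxDr. Qed.

Lemma range_trZ m n (A : 'M[R]_(m, n)) a u : range_tr A u -> range_tr A (a *: u).
Proof. by move=> [y _ <-]; exists (a *: y) => //; rewrite scalemxAr. Qed.

Lemma range_tr_rowv m n (A : 'M[R]_(m, n)) i : range_tr A (rowv A i).
Proof. by exists (delta_mx i 0) => //; rewrite -trmx_delta -trmx_mul -rowE. Qed.

Lemma range_trP m n (A : 'M[R]_(m, n)) (u : 'cV[R]_n) :
  range_tr A u <-> (u^T <= A)%MS.
Proof.
split=> [[y _ <-]|/submxP[D h]]; first by rewrite trmx_mul trmxK submxMl.
by exists D^T => //; rewrite -trmx_mul -h trmxK.
Qed.

Lemma range_null_orthogonal m n (A : 'M[R]_(m, n)) u v :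
  range_tr A u -> null_space A v -> dotv u v = 0.
Proof.
by move=> [y _ <-] Av0; rewrite dotv_trmx Av0 dotvC dotv0l.
Qed.

(** The row space of A and the kernel are orthogonal, hence meet trivially, and
    their dimensions add up to n by rank-nullity. *)
Lemma range_null_decomposition m n (A : 'M[R]_(m, n)) (v : 'cV[R]_n) :
  exists r z, [/\ range_tr A r, null_space A z & v = r + z].
Proof.
pose K := kermx A^T.
have KA0 : K *m A^T = 0 by exact: mulmx_ker.
have cap0 : (A :&: K)%MS = 0.
  apply/eqP; rewrite -submx0; apply/rV_subP => w; rewrite sub_capmx => /andP[wA wK].
  have rw : range_tr A w^T by apply/range_trP; rewrite trmxK.
  have nw : null_space A w^T.
    have /submxP[D ->] := wK.
    by rewrite /null_space/= -[A in LHS]trmxK -trmx_mul -mulmxA KA0 mulmx0 trmx0.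
  have /eqP := range_null_orthogonal rw nw; rewrite dotv_eq0 => /eqP.
  by move=> /(congr1 trmx); rewrite trmxK trmx0 => ->; exact: sub0mx.
have full : (1%:M <= A + K)%MS.
  rewrite sub1mx /row_full.
  have := mxrank_sum_cap A K; rewrite cap0 mxrank0 addn0 mxrank_ker mxrank_tr => ->.
  by rewrite subnKC// rank_leq_col.
have /sub_addsmxP[[a c] /= vE] := submx_trans (submx1 v^T) full.
exists (a *m A)^T, (c *m K)^T; split.
- by apply/range_trP; rewrite trmxK submxMl.
- by rewrite /null_space/= -[A in LHS]trmxK -trmx_mul -mulmxA KA0 mulmx0 trmx0.
- by rewrite -[LHS]trmxK vE linearD.
Qed.

(** The difference of two candidates lies in S and is also a difference of two
    residuals, each orthogonal to S. *)
Lemma orth_proj_unique n (S : set 'cV[R]_n) (v p : 'cV[R]_n) :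
  (forall a b, S a -> S b -> S (a - b)) -> S p ->
  (forall w, S w -> dotv (v - p) w = 0) -> orth_proj S v = p.
Proof.
move=> SB Sp vp; apply: xget_subset1 => // q1 q2 [Sq1 vq1] [Sq2 vq2].
apply/eqP; rewrite -subr_eq0 -dotv_eq0.
have {1}-> : q1 - q2 = (v - q2) - (v - q1) by rewrite opprB [RHS]addrC subrKA.
by rewrite dotvDl dotvNl vq1 ?vq2 ?subrr//; exact: SB.
Qed.

(** Both projections can be read off one orthogonal decomposition; this is the
    only way in which [rpart] and [npart] are used afterwards. *)
Lemma rpart_npartP m n (A : 'M[R]_(m, n)) (v : 'cV[R]_n) :
  [/\ range_tr A (rpart A v), null_space A (npart A v) & v = rpart A v + npart A v].
Proof.
have [r [z [Ar Az vE]]] := range_null_decomposition A v.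
have -> : rpart A v = r.
  apply: orth_proj_unique => // [a b Aa Ab|w Aw].
    by rewrite -scaleN1r; apply: range_trD => //; exact: range_trZ.
  by rewrite vE addrC addKr dotvC (range_null_orthogonal Aw).
have -> // : npart A v = z.
apply: orth_proj_unique => // [a b|w Aw].
  by rewrite /null_space/= => Aa Ab; rewrite mulmxBr Aa Ab subrr.
by rewrite vE addrK (range_null_orthogonal Ar).
Qed.

(** * The smallest nonzero singular value as a minimum over the row space *)

(** Where this form is nonnegative on the row space, A expands lengths there by
    at least the square root of l. *)
Definition rayleigh_gap m n (A : 'M[R]_(m, n)) (l : R) (u : 'cV[R]_n) : R :=
  dotv (A *m u) (A *m u) - l * dotv u u.

Lemma mulmx_coord_continuous n p (B : 'M[R]_(n, p)) (j : 'I_p) :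
  continuous (fun x : 'rV[R]_n => (x *m B) 0 j).
Proof.
have -> : (fun x : 'rV[R]_n => (x *m B) 0 j)
        = (fun x => \sum_k x 0 k * B k j).
  by apply/funext => x; rewrite mxE.
apply: continuous_big => [[x1 x2] /=|k _ x]; first exact: add_continuous.
by apply: continuousM; [exact: coord_continuous|exact: cst_continuous].
Qed.

Lemma dotv_mulmx_continuous n p (B : 'M[R]_(n, p)) :
  continuous (fun x : 'rV[R]_n => dotv (x *m B)^T (x *m B)^T).
Proof.
have -> : (fun x : 'rV[R]_n => dotv (x *m B)^T (x *m B)^T)
        = (fun x => \sum_j (x *m B) 0 j * (x *m B) 0 j).
  by apply/funext => x; rewrite dotvE; apply: eq_bigr => j _; rewrite mxE.
apply: continuous_big => [[x1 x2] /=|j _ x]; first exact: add_continuous.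
by apply: continuousM; exact: mulmx_coord_continuous.
Qed.

(** Closedness comes from writing membership in the row space as the vanishing of
    the product with [cokermx A]. *)
Lemma compact_unit_sphere_row_space m n (A : 'M[R]_(m, n)) :
  compact [set u : 'rV[R]_n | (u <= A)%MS /\ dotv u^T u^T = 1].
Proof.
apply: bounded_closed_compact.
  exists 1; split=> // M M1 u /= [_ u1].
  apply: le_trans (ltW M1); rewrite [leLHS]/Num.norm /= mx_normrE.
  apply: bigmax_le => // -[i j] _ /=.
  (* The topology uses the max norm: each coordinate is at most the length. *)
  rewrite -(@ler_pXn2r _ 2)// ?nnegrE// expr1n -u1 dotvE real_normK ?num_real//.
  rewrite (bigD1 j)//= !mxE -expr2 (ord1 i) lerDl.
  by apply: sumr_ge0 => k _; rewrite -expr2 sqr_ge0.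
have -> : [set u : 'rV[R]_n | (u <= A)%MS /\ dotv u^T u^T = 1]
  = \bigcap_(j in setT) ((fun u : 'rV[R]_n => (u *m cokermx A) 0 j) @^-1` [set 0])
    `&` ((fun u : 'rV[R]_n => dotv (u *m 1%:M)^T (u *m 1%:M)^T) @^-1` [set 1]).
  apply/seteqP; split=> u /=; rewrite mulmx1 => -[uA u1]; split => //.
    by move=> j _ /=; move: uA; rewrite submxE => /eqP ->; rewrite mxE.
  rewrite submxE; apply/eqP/rowP => j; rewrite [RHS]mxE.
  exact: (uA j I).
apply: closedI.
  apply: closed_bigI => j _; apply: preimage_closed.
    by move=> u _; exact: mulmx_coord_continuous.
  exact: closed_eq.
apply: preimage_closed; last exact: closed_eq.
by move=> u _; exact: dotv_mulmx_continuous.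
Qed.

Lemma range_rayleigh_minimum m n (A : 'M[R]_(m, n)) : A != 0 ->
  exists u0, [/\ range_tr A u0, dotv u0 u0 = 1 &
    forall v, range_tr A v -> 0 <= rayleigh_gap A (dotv (A *m u0) (A *m u0)) v].
Proof.
move=> A0.
pose S := [set u : 'rV[R]_n | (u <= A)%MS /\ dotv u^T u^T = 1].
have normalize v : range_tr A v -> v != 0 -> S ((Num.sqrt (dotv v v))^-1 *: v)^T.
  move=> Av v0; split; first by apply/range_trP; exact: range_trZ.
  rewrite trmxK !dotv_lin mulrA -expr2 exprVn sqr_sqrtr ?dotv_ge0//.
  by rewrite mulVf// dotv_eq0.
have [i Ai0] := exists_rowv_neq0 A0.
have S0 : S !=set0.
  by exists ((Num.sqrt (dotv (rowv A i) (rowv A i)))^-1 *: rowv A i)^T;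
    apply: normalize => //; exact: range_tr_rowv.
have [c] := EVT_min_rV S0 (@compact_unit_sphere_row_space _ _ A)
  (continuous_subspaceT (@dotv_mulmx_continuous _ _ A^T)).
rewrite inE => -[cA c1] cmin.
exists c^T; split => //; first by apply/range_trP; rewrite trmxK.
move=> v Av; rewrite /rayleigh_gap subr_ge0.
have [->|v0] := eqVneq v 0.
  by rewrite mulmx0 !dotv0l mulr0.
have := cmin _ (mem_set (normalize _ Av v0)).
rewrite !trmx_mul !trmxK -scalemxAr !dotv_lin mulrA -expr2 exprVn.
by rewrite sqr_sqrtr ?dotv_ge0// mulrC ler_pdivlMr// dotv_gt0.
Qed.

(** First-order optimality. With g the residual A^T A u0 - l u0, which lies in the
    row space, the gap along u0 + t g equals 2 t |g|^2 + O(t^2); it would be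
    negative for small t < 0 unless g = 0. *)
Lemma rayleigh_minimizer_eigenvector m n (A : 'M[R]_(m, n)) l u0 :
  range_tr A u0 -> rayleigh_gap A l u0 = 0 ->
  (forall v, range_tr A v -> 0 <= rayleigh_gap A l v) ->
  A^T *m (A *m u0) = l *: u0.
Proof.
move=> Au0 q0 qge0.
set g := A^T *m (A *m u0) - l *: u0.
have Ag : range_tr A g.
  rewrite /g -scaleNr; apply: range_trD; first by exists (A *m u0).
  exact: range_trZ.
have residualE w : dotv g w = dotv (A *m u0) (A *m w) - l * dotv u0 w.
  by rewrite /g dotvDl dotvNl dotvZl dotv_trmx.
have expand t :
    rayleigh_gap A l (u0 + t *: g) = 2 * t * dotv g g + t ^+ 2 * rayleigh_gap A l g.
  rewrite [in RHS]residualE; move: g {residualE Ag} => g; move: q0.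
  rewrite /rayleigh_gap mulmxDr -scalemxAr !dotv_lin.
  rewrite (dotvC g u0) (dotvC (A *m g) (A *m u0)).
  by move=> /eqP; rewrite subr_eq0 => /eqP ->; ring.
apply/eqP; rewrite -subr_eq0 -dotv_eq0 -/g.
apply/negPn/negP => g0.
have gpos : 0 < dotv g g by rewrite lt_neqAle eq_sym g0 dotv_ge0.
pose D := rayleigh_gap A l g.
have Dge0 : 0 <= D by exact: qge0.
have D1 : 0 < 1 + D by lra.
(* A step of size |g|^2 / (1 + D) against g makes the linear term dominate
   whatever the size of the second-order coefficient D. *)
have := qge0 _ (range_trD Au0 (range_trZ (- (dotv g g / (1 + D))) Ag)).
rewrite expand -/D.
set t := dotv g g / (1 + D).
have tpos : 0 < t by rewrite divr_gt0.
have -> : dotv g g = t * (1 + D) by rewrite /t divfK// gt_eqF.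
have : 0 < t * t by rewrite mulr_gt0.
nra.
Qed.

(** The minimum l of |A u|^2 on the unit sphere of the row space is positive, since
    the row space meets the null space only in 0. Its square root is a singular
    value; any other nonzero singular value comes from an eigenvector in the row
    space and is therefore at least as large. *)
Lemma sigma_min_range_bound m n (A : 'M[R]_(m, n)) : A != 0 ->
  0 < sigma_min A ^+ 2 /\
  forall v, range_tr A v ->
    sigma_min A ^+ 2 * dotv v v <= dotv (A *m v) (A *m v).
Proof.
move=> A0.
have [u0 [Au0 u01 min0]] := range_rayleigh_minimum A0.
set l := dotv (A *m u0) (A *m u0) in min0.
have u0N0 : u0 != 0 by rewrite -dotv_eq0 u01 oner_eq0.
have lge0 : 0 <= l by exact: dotv_ge0.
have lgt0 : 0 < l.
  rewrite lt_neqAle lge0 andbT eq_sym dotv_eq0; apply/negP => /eqP Au.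
  by have := range_null_orthogonal Au0 Au; rewrite u01 => /eqP; rewrite oner_eq0.
have eig : A^T *m (A *m u0) = l *: u0.
  by apply: rayleigh_minimizer_eigenvector => //; rewrite /rayleigh_gap u01 mulr1 subrr.
have bound v : range_tr A v -> l * dotv v v <= dotv (A *m v) (A *m v).
  by move=> /min0; rewrite /rayleigh_gap subr_ge0.
have sE : sigma_min A = Num.sqrt l.
  have sing : singular_value A (Num.sqrt l) /\ Num.sqrt l != 0.
    split; last by rewrite sqrtr_eq0 -ltNge.
    split; first exact: sqrtr_ge0.
    apply/eigenvalueP; exists u0^T; last first.
      by apply: contraNneq u0N0 => /(congr1 trmx); rewrite trmxK trmx0 => ->.
    have := congr1 trmx eig.
    by rewrite !trmx_mul trmxK linearZ/= sqr_sqrtr// mulmxA.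
  have lb s : singular_value A s /\ s != 0 -> Num.sqrt l <= s.
    move=> [[s0 /eigenvalueP[v vE v0]] sN0].
    have s2N0 : s ^+ 2 != 0 by rewrite sqrf_eq0.
    have vtE : A^T *m (A *m v^T) = s ^+ 2 *: v^T.
      by have := congr1 trmx vE; rewrite !trmx_mul trmxK linearZ -mulmxA.
    (* An eigenvector v = A^T (A v / s^2) lies in the row space as s != 0. *)
    have Av : range_tr A v^T.
      exists ((s ^+ 2)^-1 *: (A *m v^T)) => //.
      by rewrite -scalemxAr vtE scalerA mulVf// scale1r.
    have := bound _ Av; rewrite -dotv_trmx vtE dotvZl ler_pM2r; last first.
      rewrite dotv_gt0; apply: contraNneq v0 => /(congr1 trmx).
      by rewrite trmxK trmx0 => ->.
    by move=> ls; rewrite -(ger0_norm s0) -sqrtr_sqr ler_wsqrtr.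
  apply/le_anti/andP; split.
    by apply: ge_inf => //; exists (Num.sqrt l) => s; exact: lb.
  by apply: lb_le_inf => [|s]; [exists (Num.sqrt l)|exact: lb].
have s2E : sigma_min A ^+ 2 = l by rewrite sE sqr_sqrtr.
by rewrite s2E; split.
Qed.

(** * The one-step estimate and its iteration *)

Definition row_weight m n (A : 'M[R]_(m, n)) (j : 'I_m) : R :=
  norm2 (rowv A j) ^+ 2 / frobenius A ^+ 2.

Lemma row_weight_ge0 m n (A : 'M[R]_(m, n)) j : 0 <= row_weight A j.
Proof. by rewrite divr_ge0// sqr_ge0. Qed.

Lemma sum_row_weight m n (A : 'M[R]_(m, n)) : A != 0 -> \sum_j row_weight A j = 1.
Proof.
move=> A0; rewrite -mulr_suml.
under eq_bigr do rewrite norm2_sqr.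
by rewrite -frobenius_sqr divff// gt_eqF// frobenius_sqr_gt0.
Qed.

(** Multiplying by the selection probability clears the factor 1 / |a_j|^2. For a
    nonzero row this is an equality; for a zero row the left side vanishes and the
    right side keeps r_j^2 / |A|_F^2. *)
Lemma weighted_kaczmarz_step_error m n (A : 'M[R]_(m, n)) b (xh x : 'cV[R]_n) j :
  A != 0 ->
  row_weight A j * norm2 (kaczmarz_step A b j x - xh) ^+ 2 <=
  row_weight A j * norm2 (x - xh) ^+ 2
  + ((A *m xh - b) j 0 ^+ 2 - (A *m (x - xh)) j 0 ^+ 2) / frobenius A ^+ 2.
Proof.
move=> A0; have F0 := frobenius_sqr_gt0 A0.
rewrite /row_weight !norm2_sqr ![_ / _ * _]mulrAC -mulrDl ler_pM2r ?invr_gt0//.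
set a := rowv A j; set e := x - xh; set r := (A *m xh - b) j 0.
have aeE : (A *m e) j 0 = dotv a e by rewrite -dotv_rowv.
rewrite aeE.
have [->|] := eqVneq a 0.
  by rewrite !dotv0l !mul0r expr0n/= subr0 add0r sqr_ge0.
rewrite -dotv_eq0 => a0.
have -> : kaczmarz_step A b j x - xh = e - ((dotv a e + r) / dotv a a) *: a.
  rewrite /kaczmarz_step -/a norm2_sqr addrAC -/e; congr (_ - (_ / _) *: _).
  by rewrite /r !mxE -aeE /e mulmxBr dotv_rowv !mxE; ring.
clearbody e; rewrite !dotv_lin (dotvC e a) le_eqVlt; apply/orP; left; apply/eqP.
by field.
Qed.

(** Summing the weighted errors over j turns the squares (a_j . e)^2 into |A e|^2,
    which is bounded below because e is in the row space. *)
Lemma kaczmarz_step_contraction m n (A : 'M[R]_(m, n)) b (xh x : 'cV[R]_n) :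
  A != 0 -> range_tr A (x - xh) ->
  \sum_j row_weight A j * norm2 (kaczmarz_step A b j x - xh) ^+ 2 <=
  (1 - (rtilde A)^-1) * norm2 (x - xh) ^+ 2
  + norm2 (A *m xh - b) ^+ 2 / frobenius A ^+ 2.
Proof.
move=> A0 Ae; have F0 := frobenius_sqr_gt0 A0.
apply: le_trans (ler_sum _ (fun j _ => weighted_kaczmarz_step_error b xh x j A0)) _.
rewrite big_split/= -mulr_suml sum_row_weight// mul1r -mulr_suml.
rewrite sumrB.
have sumsq p (v : 'cV[R]_p) : \sum_i v i 0 ^+ 2 = dotv v v.
  by rewrite dotvE; apply: eq_bigr => i _; rewrite expr2.
rewrite !sumsq !norm2_sqr mulrBl addrCA mulrBl mul1r [leRHS]addrC lerD2l lerD2l lerN2.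
have [_ /(_ _ Ae) h] := sigma_min_range_bound A0.
by rewrite /rtilde invf_div mulrAC ler_pM2r// invr_gt0.
Qed.

Lemma kaczmarz_step_range m n (A : 'M[R]_(m, n)) b (xh x : 'cV[R]_n) j :
  range_tr A (x - xh) -> range_tr A (kaczmarz_step A b j x - xh).
Proof.
move=> Ax; rewrite /kaczmarz_step addrAC -scaleNr; apply: range_trD => //.
by apply: range_trZ; exact: range_tr_rowv.
Qed.

(** By Cauchy-Schwarz on each row, |A u|^2 <= |A|_F^2 |u|^2, while
    sigma_min^2 |u|^2 <= |A u|^2 for u in the row space; a nonzero row of A
    serves as u. *)
Lemma contraction_factor_ge0 m n (A : 'M[R]_(m, n)) : A != 0 ->
  0 <= 1 - (rtilde A)^-1.
Proof.
move=> A0; have F0 := frobenius_sqr_gt0 A0.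
have [_ bound] := sigma_min_range_bound A0.
have [j Aj0] := exists_rowv_neq0 A0.
set u := rowv A j in Aj0.
rewrite subr_ge0 /rtilde invf_div ler_pdivrMr// mul1r.
have uu : 0 < dotv u u by rewrite dotv_gt0.
rewrite -(ler_pM2r uu); apply: (le_trans (bound u (range_tr_rowv A j))).
rewrite frobenius_sqr mulr_suml dotvE; apply: ler_sum => i _.
rewrite -dotv_rowv; exact: dotv_cauchy_schwarz.
Qed.

Definition step_mean m n (A : 'M[R]_(m, n)) b (f : 'cV[R]_n -> R) (x : 'cV[R]_n) : R :=
  \sum_j row_weight A j * f (kaczmarz_step A b j x).

(** The one-step constant equals (1 - q) c, so c is the fixed point of t |-> q t +
    (1 - q) c and the excess over c decays geometrically. *)
Lemma iter_step_mean_bound m n (A : 'M[R]_(m, n)) b (xh x : 'cV[R]_n) k :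
  A != 0 -> range_tr A (x - xh) ->
  iter k (step_mean A b) (fun y => norm2 (y - xh) ^+ 2) x <=
  (1 - (rtilde A)^-1) ^+ k * norm2 (x - xh) ^+ 2
  + norm2 (A *m xh - b) ^+ 2 / sigma_min A ^+ 2.
Proof.
move=> A0; have [s0 _] := sigma_min_range_bound A0.
have F0 := frobenius_sqr_gt0 A0.
have q0 := contraction_factor_ge0 A0.
set q : R := 1 - _ in q0 *; set c := _ / sigma_min A ^+ 2.
have c0 : 0 <= c by rewrite divr_ge0// sqr_ge0.
have cE : norm2 (A *m xh - b) ^+ 2 / frobenius A ^+ 2 = (1 - q) * c.
  rewrite /q /c /rtilde invf_div subKr.
  have sN0 : sigma_min A != 0 by move: s0; rewrite lt0r sqrf_eq0 => /andP[].
  have fN0 : frobenius A != 0 by move: F0; rewrite lt0r sqrf_eq0 => /andP[].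
  by field; rewrite sN0.
move=> Ax.
(* The term - q^k c, dropped from the final bound, is what makes the induction
   go through. *)
suff : iter k (step_mean A b) (fun y => norm2 (y - xh) ^+ 2) x
    <= q ^+ k * (norm2 (x - xh) ^+ 2 - c) + c.
  move=> /le_trans; apply; rewrite lerD2r ler_wpM2l ?exprn_ge0//.
  by rewrite gerBl.
elim: k x Ax => [|k IH] x Ax; first by rewrite expr0 mul1r subrK.
rewrite iterS {1}/step_mean.
apply: (@le_trans _ _ (\sum_j (
   q ^+ k * (row_weight A j * norm2 (kaczmarz_step A b j x - xh) ^+ 2)
   + row_weight A j * (c - q ^+ k * c)))).
  apply: ler_sum => j _.
  have := ler_wpM2l (row_weight_ge0 A j) (IH _ (kaczmarz_step_range b j Ax)).
  by move=> /le_trans; apply; rewrite le_eqVlt; apply/orP; left; apply/eqP; ring.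
rewrite big_split/= -mulr_sumr -mulr_suml sum_row_weight// mul1r.
have := ler_wpM2l (exprn_ge0 k q0) (kaczmarz_step_contraction b A0 Ax).
rewrite cE -/q -(lerD2r (c - q ^+ k * c)) => /le_trans; apply.
by rewrite le_eqVlt; apply/orP; left; apply/eqP; rewrite (exprS q); ring.
Qed.

Lemma iter_step_mean_sum m n (A : 'M[R]_(m, n)) b k
    (I : finType) (a : I -> R) (g : I -> 'cV[R]_n -> R) x :
  iter k (step_mean A b) (fun y => \sum_j a j * g j y) x =
  \sum_j a j * iter k (step_mean A b) (g j) x.
Proof.
elim: k x => // k IH x; rewrite iterS /step_mean.
under eq_bigr do rewrite IH mulr_sumr.
rewrite exchange_big/=; apply: eq_bigr => j _.
by rewrite mulr_sumr; apply: eq_bigr => l _; rewrite mulrCA.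
Qed.

End LinearAlgebraFacts.

(** * From random indices to the averaging operator *)

Section Expectation.
Context {R : realType} {d : measure_display} {T : measurableType d}.
Variables (P : probability T R) (m n : nat) (A : 'M[R]_(m, n)) (b : 'cV[R]_m).
Variables (x0 : 'cV[R]_n) (i : nat -> T -> 'I_m).
Hypothesis iA : kaczmarz_indices P A i.

Let X k w := kaczmarz A b x0 (fun t => i t w) k.

Let cylinder (J : {fset nat}) (B : nat -> set 'I_m) : set T :=
  \bigcap_(t in [set` J]) (i t @^-1` B t).

(** Finitely many indices are possible at each time, so x_k is a simple
    function: every set of vectors has a measurable preimage. *)
Lemma measurable_iterate k (S : set 'cV[R]_n) : measurable (X k @^-1` S).
Proof.
have [mi _ _] := iA.
elim: k S => [|k IH] S.
  have [Sx|Sx] := pselect (S x0).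
    rewrite (_ : _ @^-1` _ = setT); first exact: measurableT.
    by apply/seteqP; split.
  rewrite (_ : _ @^-1` _ = set0); first exact: measurable0.
  by apply/seteqP; split.
rewrite (_ : _ @^-1` _ = \bigcup_(j in [set: 'I_m])
   (i k @^-1` [set j] `&` X k @^-1` (kaczmarz_step A b j @^-1` S))).
  apply: fin_bigcup_measurable => // j _.
  by apply: measurableI; [exact: mi|exact: IH].
apply/seteqP; split=> w /=; first by move=> Sw; exists (i k w).
by move=> [j _ [/= <-]].
Qed.

Lemma measurable_fun_iterate k (f : 'cV[R]_n -> R) (D : set T) :
  measurable D -> measurable_fun D (fun w => (f (X k w))%:E).
Proof.
move=> mD _ Y _; apply: measurableI => //.
exact: (measurable_iterate k ((EFin \o f) @^-1` Y)).
Qed.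

Lemma measurable_cylinder J B : measurable (cylinder J B).
Proof.
have [mi _ _] := iA.
by apply: fin_bigcap_measurable => // t _; exact: mi.
Qed.

Lemma cylinder_addE J B k j : k \notin J ->
  cylinder J B `&` i k @^-1` [set j] =
  cylinder (k |` J)%fset (fun t => if t == k then [set j] else B t).
Proof.
move=> kJ; apply/seteqP; split=> w.
  move=> [Jw kw] t /=; rewrite in_fset1U; case: eqVneq => [->//|_ /= tJ].
  exact: Jw.
move=> Jw; split.
  move=> t tJ; have := Jw t; rewrite /= in_fset1U tJ orbT.
  case: eqVneq => [tk|_]; last exact.
  by move: kJ; rewrite -tk tJ.
by have := Jw k; rewrite /= in_fset1U eqxx; exact.
Qed.

(** The only use of independence: a constraint at a fresh time k multiplies the
    probability by the weight of the row chosen. *)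
Lemma probability_cylinder_add J B k j : k \notin J ->
  P (cylinder J B `&` i k @^-1` [set j]) = (P (cylinder J B) * (row_weight A j)%:E)%E.
Proof.
move=> kJ; have [_ ind ip] := iA.
rewrite cylinder_addE// /cylinder !ind big_fsetU1//= eqxx ip muleC; congr (_ * _)%E.
rewrite !big_seq; apply: eq_bigr => t tJ.
by case: eqVneq => // tk; move: kJ; rewrite -tk tJ.
Qed.

Lemma cylinder_split J B k :
  cylinder J B = \big[setU/set0]_(j : 'I_m) (cylinder J B `&` i k @^-1` [set j]).
Proof.
rewrite -bigcup_seq; apply/seteqP; split=> w.
  by move=> Jw; exists (i k w) => //=; rewrite mem_index_enum.
by move=> [j _ []].
Qed.

(** Since x_k depends only on the indices before time k, it is independent of any
    cylinder event C on later times. Carrying C along is what lets the induction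
    run: conditioning x_(k+1) on the value of the index k adds a constraint to C
    and leaves an integral of a function of x_k. *)
Lemma integral_iterate_cylinder k (f : 'cV[R]_n -> R) J B :
  (forall x, 0 <= f x) -> (forall t, t \in J -> (k <= t)%N) ->
  (\int[P]_(w in cylinder J B) (f (X k w))%:E =
   (iter k (step_mean A b) f x0)%:E * P (cylinder J B))%E.
Proof.
elim: k f J B => [|k IH] f J B f0 Jk.
  by rewrite /X /= integral_cst//; exact: measurable_cylinder.
have kJ : k \notin J by apply/negP => /Jk; rewrite ltnn.
have [mi _ _] := iA.
have mcyl j : measurable (cylinder J B `&` i k @^-1` [set j]).
  by apply: measurableI; [exact: measurable_cylinder|exact: mi].
have mf := measurable_fun_iterate k.+1 f (measurable_cylinder J B).
rewrite {1}(cylinder_split J B k) ge0_integral_bigsetU ?index_enum_uniq//; last 3 first.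
- apply/trivIsetP => j l _ _ jl; apply/seteqP; split=> // w /=.
  by move=> [[_ ->] [_ /eqP]]; rewrite (negbTE jl).
- by rewrite -cylinder_split.
- by move=> w _; rewrite lee_fin.
rewrite iterSr {1}/step_mean iter_step_mean_sum.
rewrite -[P (cylinder J B)]fineK ?fin_num_measure//; last exact: measurable_cylinder.
rewrite -EFinM mulr_suml -sumEFin; apply: eq_bigr => j _.
transitivity (\int[P]_(w in cylinder J B `&` i k @^-1` [set j])
    (f (kaczmarz_step A b j (X k w)))%:E)%E.
  by apply: eq_integral => w; rewrite inE => -[_ /= <-].
rewrite cylinder_addE// (IH (fun x => f (kaczmarz_step A b j x))) //.
  rewrite -cylinder_addE// probability_cylinder_add//.
  rewrite -[P (cylinder J B)]fineK ?fin_num_measure//; last exact: measurable_cylinder.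
  by rewrite -!EFinM; congr EFin; ring.
by move=> t; rewrite in_fset1U => /orP[/eqP ->|/Jk /ltnW].
Qed.

Lemma expectation_iterate k (f : 'cV[R]_n -> R) : (forall x, 0 <= f x) ->
  ('E_P[fun w => f (X k w)] = (iter k (step_mean A b) f x0)%:E)%E.
Proof.
move=> f0; rewrite unlock.
have := @integral_iterate_cylinder k f fset0 (fun=> setT) f0.
rewrite /cylinder (_ : [set` fset0] = set0); last by apply/seteqP; split.
by rewrite bigcap_set0 probability_setT mule1; apply=> t; rewrite in_fset0.
Qed.

End Expectation.

Theorem theorem5 (R : realType) (m n : nat) (A : 'M[R]_(m, n)) (b : 'cV[R]_m)
    (x0 : 'cV[R]_n) (d : measure_display) (T : measurableType d)
    (P : probability T R) (i : nat -> T -> 'I_m) :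
  A != 0 ->
  kaczmarz_indices P A i ->
  forall (xs : 'cV[R]_n) (k : nat),
    ('E_P[fun w : T =>
        (norm2 (kaczmarz A b x0 (fun t => i t w) k - npart A x0 - rpart A xs)
          ^+ 2)%R]
     <= ((1 - (rtilde A)^-1) ^+ k * norm2 (rpart A x0 - rpart A xs) ^+ 2
         + norm2 (A *m xs - b) ^+ 2 / sigma_min A ^+ 2)%:E)%E.
Proof.
move=> A0 iA xs k.
have [Ar0 An0 x0E] := rpart_npartP A x0.
have [Ars Ans xsE] := rpart_npartP A xs.
set xh := npart A x0 + rpart A xs.
(* The null-space part of x0 cancels, so the error starts in the row space. *)
have e0 : x0 - xh = rpart A x0 - rpart A xs.
  by rewrite /xh {1}x0E opprD addrA addrK.
have Axh : A *m xh = A *m xs.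
  by rewrite /xh {2}xsE !mulmxDr An0 Ans add0r addr0.
have -> : (fun w => norm2 (kaczmarz A b x0 (fun t => i t w) k
      - npart A x0 - rpart A xs) ^+ 2)
    = (fun w => norm2 (kaczmarz A b x0 (fun t => i t w) k - xh) ^+ 2).
  by apply/funext => w; rewrite /xh opprD addrA.
rewrite (expectation_iterate b x0 iA k (f := fun y => norm2 (y - xh) ^+ 2)); last first.
  by move=> y; exact: sqr_ge0.
rewrite lee_fin -Axh -e0; apply: iter_step_mean_bound => //.
by rewrite e0 -scaleN1r; apply: range_trD => //; exact: range_trZ.
Qed.
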